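(* Consider the infinity-norm safe set $\mathcal{S}_{x^a}^\infty=\{x\in\mathbb{R}^n:\|x\|_\infty\leq1\}$ and the optimal $\alpha$-stealthy bias injection attack defined as the solution of $$\max_{a_\infty}\ \|G_{xa}a_\infty\|_\infty\quad\text{s.t.}\quad \|G_{ra}a_\infty\|_2\leq\delta_\alpha,$$ which is assumed to be bounded. Let $e_i$ be the $i$-th column of the $n\times n$ identity matrix, and denote by $\lambda_i^*$ and $v_i^*$ the largest generalized eigenvalue and a corresponding unit-norm generalized eigenvector of the matrix pencil $G_{xa}^\top e_ie_i^\top G_{xa}-\lambda G_{ra}^\top G_{ra}$. Let $\lambda^*=\max_i\lambda_i^*$, with $v^*$ the corresponding generalized eigenvector (i.e., $v^*=v_i^*$ for an index $i$ attaining the maximum). Then the optimal bias attack is given by $$a^*_\infty=\pm\frac{\delta_\alpha}{\|G_{ra}v^*\|_2}v^*$$ (i.e., these vectors attain the maximum), and the corresponding optimal value is $\|G_{xa}a^*_\infty\|_\infty=\sqrt{\lambda^*}\,\delta_\alpha$. Moreover, at steady state under this attack the system is in a safe state, i.e. $x^a_\infty=G_{xa}a^*_\infty\in\mathcal{S}_{x^a}^\infty$, if and only if $\lambda^*\delta_\alpha^2\leq1$.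
   Context: $\delta_\alpha>0$ is a real number and $a_\infty\in\mathbb{R}^s$ is a constant (steady-state) attack bias. The matrices $G_{xa}\in\mathbb{R}^{n\times s}$ and $G_{ra}\in\mathbb{R}^{p_d\times s}$ (with $G_{ra}\ne0$, so that generalized eigenvalues exist) are the steady-state gains from the bias to the plant state ($x^a_\infty=G_{xa}a_\infty$) and to the detector residual ($r^a_\infty=G_{ra}a_\infty$): $$G_{xa}=[I\ \ 0](I-\mathbf{A})^{-1}\mathbf{B},\qquad G_{ra}=\mathbf{C}_e(I-\mathbf{A}_e)^{-1}\mathbf{B}_e+\mathbf{D}_e .$$ They come from the attack-induced closed-loop dynamics $\eta^a_{k+1}=\mathbf{A}\eta^a_k+\mathbf{B}a_k$, with $\eta^a_k=[x_k^{a\top}\ z_k^{a\top}]^\top$ (plant state $x^a_k\in\mathbb{R}^n$ and controller state $z^a_k\in\mathbb{R}^m$), and the attack-induced anomaly detector dynamics $\xi^a_{k|k}=\mathbf{A}_e\xi^a_{k-1|k-1}+\mathbf{B}_ea_{k-1}$, $r^a_k=\mathbf{C}_e\xi^a_{k-1|k-1}+\mathbf{D}_ea_{k-1}$. Here $$\mathbf{A}=\begin{bmatrix} A+BD_cC & BC_c \\ {B_c}C & A_c \end{bmatrix},\quad \mathbf{A}_e=(I-KC)A,\quad \mathbf{C}_e=VC(I-KC)A,$$ where $A,B,C$ are the plant matrices, $A_c,B_c,C_c,D_c$ the controller matrices and $K,V$ the detector gains, while $\mathbf{B},\mathbf{B}_e,\mathbf{D}_e$ are real matrices of compatible dimensions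 describing how the attack enters. The inverses above are assumed to exist. The optimization problem is bounded if its objective is bounded above on the feasible set. A bias is ($\alpha$-)stealthy at steady state if $\|G_{ra}a_\infty\|_2\le\delta_\alpha$. A scalar $\lambda$ is a generalized eigenvalue of a pencil $P-\lambda Q$, also written $(P,Q)$, if $\mathrm{rank}(P-\lambda Q)<\mathrm{normalrank}(P,Q)$, where $\mathrm{normalrank}(P,Q)$ is the rank of $P-\nu Q$ for almost all $\nu\in\mathbb{C}$. A generalized eigenvector associated with $\lambda$ is a vector $v$ with $(P-\lambda Q)v=0$ and $v\notin\ker(Q)$. *)

(* Defs.v *)
From HB Require Import structures.
From mathcomp Require Import all_boot all_order all_algebra.
From mathcomp Require Import all_classical all_reals all_analysis.
From mathcomp Require Import complex.
Set Implicit Arguments.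
Unset Strict Implicit.
Unset Printing Implicit Defensive.
Import Order.TTheory GRing.Theory Num.Theory.
Import numFieldNormedType.Exports.
Local Open Scope classical_set_scope.
Local Open Scope ring_scope.

(* On matrices, hence on column vectors, the library norm `|x| is the
   maximum of the absolute values of the entries, i.e. the infinity norm. *)
Definition norm2 (R : realType) (n : nat) (x : 'cV[R]_n) : R :=
  Num.sqrt (\sum_i x i 0 ^+ 2).

(* "For almost all nu" means for all but finitely many nu in R[i].  This is a
   relation; r is uniquely determined because R[i] is infinite. *)
Definition is_normalrank (R : realType) (m n : nat)
    (P Q : 'M[R[i]]_(m, n)) (r : nat) : Prop :=
  exists exc : seq R[i],
    forall nu : R[i], nu \notin exc -> \rank (P - nu *: Q) = r.

Definition gen_eigenvalue (R : realType) (m n : nat)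
    (P Q : 'M[R[i]]_(m, n)) (lam : R[i]) : Prop :=
  exists r : nat, is_normalrank P Q r /\ (\rank (P - lam *: Q)%R < r)%N.

Definition gen_eigenvector (F : fieldType) (m n : nat)
    (P Q : 'M[F]_(m, n)) (lam : F) (v : 'cV[F]_n) : Prop :=
  (P - lam *: Q) *m v = 0 /\ Q *m v <> 0.

(* Generalized eigenvalues of a real pencil are taken in R[i].  In R[i],
   mu <= lam%:C means that mu is real and at most lam, so this also says that
   every generalized eigenvalue is real. *)
Definition largest_gen_eigenvalue (R : realType) (m n : nat)
    (P Q : 'M[R]_(m, n)) (lam : R) : Prop :=
  let PC := map_mx (real_complex R) P in
  let QC := map_mx (real_complex R) Q in
  gen_eigenvalue PC QC (real_complex R lam) /\
  forall mu : R[i], gen_eigenvalue PC QC mu -> mu <= real_complex R lam.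

(* Dimensions: n plant state, m controller state, q plant input, p plant
   output, pd residual, s attack. *)
Definition closed_loop (R : realType) (n m q p : nat)
    (A : 'M[R]_n) (B : 'M[R]_(n, q)) (C : 'M[R]_(p, n))
    (Ac : 'M[R]_m) (Bc : 'M[R]_(m, p)) (Cc : 'M[R]_(q, m))
    (Dc : 'M[R]_(q, p)) : 'M[R]_(n + m) :=
  block_mx (A + B *m Dc *m C) (B *m Cc) (Bc *m C) Ac.

Definition detector_A (R : realType) (n p : nat)
    (A : 'M[R]_n) (C : 'M[R]_(p, n)) (K : 'M[R]_(n, p)) : 'M[R]_n :=
  (1%:M - K *m C) *m A.

Definition detector_C (R : realType) (n p pd : nat)
    (A : 'M[R]_n) (C : 'M[R]_(p, n)) (K : 'M[R]_(n, p)) (V : 'M[R]_(pd, p)) :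
    'M[R]_(pd, n) :=
  V *m C *m (1%:M - K *m C) *m A.

Definition state_gain (R : realType) (n m s : nat)
    (bA : 'M[R]_(n + m)) (bB : 'M[R]_(n + m, s)) : 'M[R]_(n, s) :=
  row_mx 1%:M 0 *m invmx (1%:M - bA) *m bB.

Definition residual_gain (R : realType) (n pd s : nat)
    (Ae : 'M[R]_n) (Be : 'M[R]_(n, s))
    (Ce : 'M[R]_(pd, n)) (De : 'M[R]_(pd, s)) : 'M[R]_(pd, s) :=
  Ce *m invmx (1%:M - Ae) *m Be + De.

Definition safe_set (R : realType) (n : nat) : set 'cV[R]_n :=
  [set x | `|x| <= 1].
Arguments safe_set R n : clear implicits.

Definition stealthy (R : realType) (pd s : nat)
    (Gra : 'M[R]_(pd, s)) (delta : R) (a : 'cV[R]_s) : Prop :=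
  norm2 (Gra *m a) <= delta.

Definition bounded_attack_problem (R : realType) (n pd s : nat)
    (Gxa : 'M[R]_(n, s)) (Gra : 'M[R]_(pd, s)) (delta : R) : Prop :=
  exists M : R, forall a : 'cV[R]_s, stealthy Gra delta a -> `|Gxa *m a| <= M.

Definition optimal_attack (R : realType) (n pd s : nat)
    (Gxa : 'M[R]_(n, s)) (Gra : 'M[R]_(pd, s)) (delta : R)
    (a : 'cV[R]_s) : Prop :=
  stealthy Gra delta a /\
  forall b : 'cV[R]_s, stealthy Gra delta b -> `|Gxa *m b| <= `|Gxa *m a|.

(* Main.v *)
Require Import Defs.
From HB Require Import structures.
From mathcomp Require Import all_boot all_order all_algebra.
From mathcomp Require Import all_classical all_reals all_analysis.
From mathcomp Require Import complex ring lra.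
Set Implicit Arguments.
Unset Strict Implicit.
Unset Printing Implicit Defensive.
Import Order.TTheory GRing.Theory Num.Theory.
Import numFieldNormedType.Exports.
Local Open Scope classical_set_scope.
Local Open Scope ring_scope.

(** Write h for row i of Gxa, so that P i = h^T h, and Q = Gra^T Gra.  If Gra
    kills a bias, every multiple of it is stealthy, so boundedness forces Gxa
    to kill it too ([bounded_attack_ker]).  As Q has the same kernel as Gra,
    this puts the rows of Gxa in the row space of Q: h = u^T Q for some u
    ([bounded_attack_submx]), which makes the pencil explicit:
    [P i - nu Q = Q (u h - nu I)].

    The factor [u h - nu I] is a rank-one perturbation of a scalar matrix, and
    is singular at most for nu = 0 and nu = h u = |Gra u|^2.  Hence the normal
    rank is rank Q, and 0 and |Gra u|^2 are the only candidates for generalized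
    eigenvalues, even complex ones.  The larger one, |Gra u|^2, always has a
    generalized eigenvector, so it is the largest generalized eigenvalue
    ([largest_gen_eigenvalue_rank_one]).

    Coordinate i of Gxa b is the inner product of Gra u and Gra b, so by
    Cauchy-Schwarz it is at most sqrt (lambda_i) |Gra b| in absolute value
    ([attack_coordinate_le]), and an eigenvector for lambda_i attains equality
    ([gen_eigenvector_coordinate]).  Maximizing over i, an eigenvector for the
    largest lambda_i, scaled so that |Gra a| = delta, is optimal with value
    sqrt (lambda_istar) delta; safety is this value being at most 1, squared. *)

(** * The Euclidean norm and Gram matrices *)

Lemma norm2_sq (R : realType) (n : nat) (x : 'cV[R]_n) :
  norm2 x ^+ 2 = (x^T *m x) 0 0.
Proof.
rewrite sqr_sqrtr; last by apply: sumr_ge0 => i _; exact: sqr_ge0.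
by rewrite mxE; apply: eq_bigr => i _; rewrite mxE expr2.
Qed.

Lemma norm2_ge0 (R : realType) (n : nat) (x : 'cV[R]_n) : 0 <= norm2 x.
Proof. exact: sqrtr_ge0. Qed.

Lemma norm2_eq0 (R : realType) (n : nat) (x : 'cV[R]_n) :
  (norm2 x == 0) = (x == 0).
Proof.
have sq_ge0 i : true -> 0 <= x i 0 ^+ 2 by move=> _; exact: sqr_ge0.
rewrite sqrtr_eq0; apply/idP/eqP => [xsq_le0 | ->]; last first.
  by rewrite big1 // => i _; rewrite mxE expr0n.
have xsq0 : \sum_i x i 0 ^+ 2 = 0.
  by apply/eqP; rewrite eq_le xsq_le0 sumr_ge0.
apply/matrixP=> i j; rewrite ord1 mxE.
by apply/eqP; rewrite -sqrf_eq0 (psumr_eq0P sq_ge0 xsq0).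
Qed.

Lemma norm2Z (R : realType) (n : nat) (c : R) (x : 'cV[R]_n) :
  norm2 (c *: x) = `|c| * norm2 x.
Proof.
rewrite /norm2 -sqrtr_sqr -sqrtrM ?sqr_ge0 // mulr_sumr.
by congr Num.sqrt; apply: eq_bigr => i _; rewrite mxE exprMn.
Qed.

(** Up to the factor |x|^2, the gap between the two sides is the squared norm of
    [|x|^2 y - <x, y> x], a multiple of the component of y orthogonal to x. *)
Lemma cauchy_schwarz_norm2 (R : realType) (n : nat) (x y : 'cV[R]_n) :
  (x^T *m y) 0 0 ^+ 2 <= norm2 x ^+ 2 * norm2 y ^+ 2.
Proof.
have [->|x_neq0] := eqVneq x 0.
  by rewrite trmx0 mul0mx mxE expr0n mulr_ge0 ?sqr_ge0.
have x_gt0 : 0 < norm2 x ^+ 2.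
  by rewrite exprn_gt0 // lt_neqAle norm2_ge0 eq_sym norm2_eq0 x_neq0.
have residual_sq a b : norm2 (a *: y - b *: x) ^+ 2 =
    a ^+ 2 * norm2 y ^+ 2 - (a * b *+ 2) * (x^T *m y) 0 0 + b ^+ 2 * norm2 x ^+ 2.
  rewrite !norm2_sq !mxE !mulr_sumr -sumrB -big_split.
  by apply: eq_bigr => i _; rewrite !mxE /=; ring.
rewrite -subr_ge0 -(pmulr_rge0 _ x_gt0).
have := sqr_ge0 (norm2 (norm2 x ^+ 2 *: y - (x^T *m y) 0 0 *: x)).
by rewrite residual_sq; congr (0 <= _); ring.
Qed.

(** For a column x, [x^T (G^T G) x = |G x|^2], so over the reals the Gram matrix
    kills no more than G itself. *)
Lemma gram_mulmx_eq0 (R : realType) (m n k : nat)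
    (G : 'M[R]_(m, n)) (X : 'M[R]_(n, k)) :
  G^T *m G *m X = 0 -> G *m X = 0.
Proof.
move=> GX0; apply/matrixP => i j.
have : norm2 (G *m col j X) = 0.
  have Gx0 : G^T *m (G *m col j X) = 0 by rewrite colE !mulmxA GX0 mul0mx.
  by apply/eqP; rewrite -sqrf_eq0 norm2_sq trmx_mul -mulmxA Gx0 mulmx0 mxE.
move/eqP; rewrite norm2_eq0 colE mulmxA -colE => /eqP/matrixP/(_ i 0).
by rewrite !mxE.
Qed.

Lemma normmx_le_cV (R : realType) (n : nat) (x : 'cV[R]_n) (c : R) :
  0 <= c -> `|x| <= c <-> forall i, `|x i 0| <= c.
Proof.
move=> c_ge0; rewrite [`|x|]mx_normrE; split=> [|x_le].
  by move=> /bigmax_leP[_ x_le] i; exact: (x_le (i, 0)).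
by apply/bigmax_leP; split=> // -[i j] _ /=; rewrite ord1.
Qed.

(** * What boundedness says about the gains *)

(** All multiples of a bias that is invisible to the detector are stealthy, so
    any effect of it on the state could be scaled up without limit. *)
Lemma bounded_attack_ker (R : realType) (n pd s : nat)
    (Gxa : 'M[R]_(n, s)) (Gra : 'M[R]_(pd, s)) (delta : R) (a : 'cV[R]_s) :
  0 < delta -> bounded_attack_problem Gxa Gra delta ->
  Gra *m a = 0 -> Gxa *m a = 0.
Proof.
move=> delta_gt0 [M bndM] Ga0; apply/eqP; apply/negPn/negP => Gxa_neq0.
have x_gt0 : 0 < `|Gxa *m a| by rewrite normr_gt0.
(* The scaling for which the state has norm |M| + 1, beyond the bound M. *)
pose t := (`|M| + 1) / `|Gxa *m a|.
have /bndM : stealthy Gra delta (t *: a).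
  by rewrite /stealthy -scalemxAr Ga0 norm2Z (eqP (_ : norm2 0 == 0)) ?norm2_eq0
    // mulr0 ltW.
rewrite -scalemxAr normrZ ger0_norm ?divr_ge0 ?addr_ge0 //.
rewrite divfK ?gt_eqF //; have := ler_norm M; lra.
Qed.

(** A row space is the annihilator of a kernel: it suffices that Gxa vanishes on
    the cokernel of the Gram matrix, whose columns lie in the kernel of Gra. *)
Lemma bounded_attack_submx (R : realType) (n pd s : nat)
    (Gxa : 'M[R]_(n, s)) (Gra : 'M[R]_(pd, s)) (delta : R) :
  0 < delta -> bounded_attack_problem Gxa Gra delta ->
  (Gxa <= Gra^T *m Gra)%MS.
Proof.
move=> delta_gt0 bnd; rewrite submxE; apply/eqP.
have := gram_mulmx_eq0 (mulmx_coker (Gra^T *m Gra)).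
move: (cokermx _) => X GraX0; apply/matrixP => i j.
have /matrixP/(_ i 0) : Gxa *m col j X = 0.
  by apply: bounded_attack_ker delta_gt0 bnd _; rewrite colE mulmxA GraX0 mul0mx.
by rewrite colE mulmxA -colE !mxE.
Qed.

(** * Generalized eigenvalues of a rank-one pencil *)

(** The pencil factors as [Q (u h - nu I)].  If [x u h = nu x] with x a row, then
    multiplying by u gives [(x u) (h u) = nu (x u)], so [x u = 0] because
    [nu <> h u], and then [x = 0] because [nu <> 0]: the second factor is
    invertible.  The field is arbitrary so that the complex values of nu in the
    definition of a generalized eigenvalue are covered. *)
Lemma rank_pencil_rank_one (F : fieldType) (m n : nat)
    (Q : 'M[F]_(m, n)) (u : 'cV[F]_n) (h : 'rV[F]_n) (nu : F) :
  nu != 0 -> nu != (h *m u) 0 0 ->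
  \rank (Q *m u *m h - nu *: Q) = \rank Q.
Proof.
move=> nu_neq0 nu_neq.
have -> : Q *m u *m h - nu *: Q = Q *m (u *m h - nu%:M).
  by rewrite mulmxBr mulmxA mul_mx_scalar.
apply/mxrankMfree/inj_row_free => x.
rewrite mulmxBr mulmxA mul_mx_scalar => /eqP; rewrite subr_eq0 => /eqP xE.
have /eqP : (x *m u) *m (h *m u) = nu *: (x *m u).
  by rewrite mulmxA xE scalemxAl.
rewrite [h *m u]mx11_scalar mul_mx_scalar -subr_eq0 -scalerBl scaler_eq0.
rewrite subr_eq0 eq_sym (negPf nu_neq) => /eqP xu0.
by move/eqP: xE; rewrite xu0 mul0mx eq_sym scaler_eq0 (negPf nu_neq0) => /eqP.
Qed.

(** The row space of the pencil at lam lies in that of Q, and strictly: the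
    eigenvector is annihilated by the pencil but not by Q.  So, when Q has the
    normal rank, having an eigenvector is enough to be an eigenvalue. *)
Lemma gen_eigenvector_rank_lt (F : fieldType) (m n : nat)
    (P Q : 'M[F]_(m, n)) (lam : F) (v : 'cV[F]_n) :
  (P <= Q)%MS -> gen_eigenvector P Q lam v ->
  (\rank (P - lam *: Q)%R < \rank Q)%N.
Proof.
move=> PQ [Pv0 Qv_neq0].
have pencilQ : (P - lam *: Q <= Q)%MS.
  by rewrite addmx_sub // eqmx_opp scalemx_sub.
rewrite (ltn_leqif (mxrank_leqif_sup pencilQ)); apply/negP => /submxP[D QE].
by apply: Qv_neq0; rewrite QE -mulmxA Pv0 mulmx0.
Qed.

(** Used to evaluate two generic ranks at a common point, outside both finite
    sets of exceptions. *)
Lemma exists_notin (F : numDomainType) (s : seq F) : exists x : F, x \notin s.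
Proof.
have bound y : y \in s -> `|y| <= \sum_(z <- s) `|z|.
  by move=> y_in; rewrite (big_rem _ y_in) lerDl sumr_ge0.
exists (1 + \sum_(y <- s) `|y|); apply/negP => /bound.
by rewrite ger0_norm ?addr_ge0 ?sumr_ge0 // gerDr ler10.
Qed.

Lemma largest_gen_eigenvalue_unique (R : realType) (m n : nat)
    (P Q : 'M[R]_(m, n)) (lam mu : R) :
  largest_gen_eigenvalue P Q lam -> largest_gen_eigenvalue P Q mu -> lam = mu.
Proof.
move=> [lam_ev lam_max] [mu_ev mu_max]; apply/eqP; rewrite eq_le.
by rewrite -!lecR lam_max ?mu_max.
Qed.

Lemma gen_eigenvector_unit (R : realType) (m n : nat)
    (P Q : 'M[R]_(m, n)) (lam : R) (v : 'cV[R]_n) :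
  gen_eigenvector P Q lam v ->
  exists2 w : 'cV[R]_n, gen_eigenvector P Q lam w & norm2 w = 1.
Proof.
move=> [Pv0 Qv_neq0].
have v_neq0 : norm2 v != 0.
  by rewrite norm2_eq0; apply/eqP => v0; apply: Qv_neq0; rewrite v0 mulmx0.
exists ((norm2 v)^-1 *: v).
  split; rewrite -scalemxAr ?Pv0 ?scaler0 // => /eqP.
  by rewrite scaler_eq0 invr_eq0 (negPf v_neq0) => /eqP.
by rewrite norm2Z ger0_norm ?invr_ge0 ?norm2_ge0 // mulVf.
Qed.

(** If G u is nonzero, u itself is an eigenvector.  If G u = 0, the matrix P of
    the pencil and the eigenvalue both vanish, so any vector outside the kernel
    of Q will do; the assumption on G provides one. *)
Lemma rank_one_gen_eigenvector (R : realType) (m n : nat)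
    (G : 'M[R]_(m, n)) (u : 'cV[R]_n) :
  G <> 0 ->
  let Q := G^T *m G in
  exists v : 'cV[R]_n,
    gen_eigenvector (Q *m u *m (u^T *m Q)) Q (norm2 (G *m u) ^+ 2) v.
Proof.
move=> G_neq0 Q.
have lamE : (u^T *m Q *m u) = (norm2 (G *m u) ^+ 2)%:M.
  by rewrite [LHS]mx11_scalar norm2_sq trmx_mul /Q !mulmxA.
have [Gu0|Gu_neq0] := eqVneq (G *m u) 0.
  have [j Qj] : exists j, col j Q != 0.
    apply/existsP; rewrite -negb_forall; apply/negP => /forallP Q0.
    apply: G_neq0; rewrite -[G]mulmx1; apply: gram_mulmx_eq0.
    rewrite mulmx1; apply/matrixP => i j.
    by move/eqP/matrixP/(_ i 0): (Q0 j); rewrite !mxE.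
  exists (delta_mx j 0); split; last by rewrite -colE; apply/eqP.
  have ->: Q *m u = 0 by rewrite /Q -mulmxA Gu0 mulmx0.
  by rewrite mul0mx (eqP (_ : norm2 _ == 0)) ?norm2_eq0 ?Gu0 // expr0n scale0r
    subr0 mul0mx.
exists u; split.
  by rewrite mulmxBl -(mulmxA (Q *m u)) lamE mul_mx_scalar -scalemxAl subrr.
by move=> /gram_mulmx_eq0 Gu0; rewrite Gu0 eqxx in Gu_neq0.
Qed.

(** Away from 0 and the claimed eigenvalue, the pencil has the rank of Q, which is
    therefore its normal rank; so no other number can be an eigenvalue, and 0
    does not exceed the claimed one, which is a square. *)
Lemma largest_gen_eigenvalue_rank_one (R : realType) (m n : nat)
    (G : 'M[R]_(m, n)) (u : 'cV[R]_n) :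
  G <> 0 ->
  let Q := G^T *m G in
  largest_gen_eigenvalue (Q *m u *m (u^T *m Q)) Q (norm2 (G *m u) ^+ 2).
Proof.
move=> G_neq0 Q; have [v evv] := rank_one_gen_eigenvector u G_neq0.
set lam := norm2 _ ^+ 2 in evv *.
have lamE : (u^T *m Q *m u) 0 0 = lam by rewrite /lam norm2_sq trmx_mul /Q !mulmxA.
rewrite /largest_gen_eigenvalue; set PC := map_mx _ _; set QC := map_mx _ _.
have generic_rank (nu : R[i]) :
    nu \notin [:: 0; lam%:C%C] -> \rank (PC - nu *: QC) = \rank Q.
  rewrite !inE negb_or => /andP[nu_neq0 nu_neq].
  rewrite -(mxrank_map (real_complex R) Q) -/QC.
  have -> : PC = QC *m map_mx (real_complex R) u
                    *m map_mx (real_complex R) (u^T *m Q).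
    by rewrite -!map_mxM.
  by apply: rank_pencil_rank_one; rewrite // -map_mxM mxE lamE.
split.
  exists (\rank Q); split; first by exists [:: 0; lam%:C%C].
  rewrite -map_mxZ -map_mxB mxrank_map; apply: gen_eigenvector_rank_lt evv.
  by rewrite mulmxA submxMl.
move=> mu [r [[exc rE] mu_lt]].
have [nu] := exists_notin (exc ++ [:: 0; lam%:C%C]).
rewrite mem_cat negb_or => /andP[/rE rank_nu /generic_rank].
rewrite rank_nu => rQ.
have [|/generic_rank muE] := boolP (mu \in [:: 0; lam%:C%C]).
  rewrite !inE => /orP[]/eqP -> //.
  by rewrite ler0c sqr_ge0.
by rewrite rQ muE ltnn in mu_lt.
Qed.

(** * Effect of a bias on one state coordinate *)

(** With Gxa = U Q, coordinate i of the state is the inner product of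
    [G (row i U)^T] and [G b]. *)
Lemma attack_coordinate_le (R : realType) (n pd s : nat)
    (U : 'M[R]_(n, s)) (G : 'M[R]_(pd, s)) (i : 'I_n) (b : 'cV[R]_s) :
  `|(U *m (G^T *m G) *m b) i 0| <= norm2 (G *m (row i U)^T) * norm2 (G *m b).
Proof.
have -> : (U *m (G^T *m G) *m b) i 0 = ((G *m (row i U)^T)^T *m (G *m b)) 0 0.
  transitivity ((row i (U *m (G^T *m G) *m b)) 0 0); first by rewrite [RHS]mxE.
  by rewrite !row_mul trmx_mul trmxK !mulmxA.
rewrite -ler_sqr ?nnegrE ?mulr_ge0 ?norm2_ge0 // real_normK ?num_real //.
by rewrite exprMn cauchy_schwarz_norm2.
Qed.

(** Multiply the eigenvector equation by v^T on the left. *)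
Lemma gen_eigenvector_coordinate (R : realType) (n pd s : nat)
    (Gxa : 'M[R]_(n, s)) (G : 'M[R]_(pd, s)) (i : 'I_n) (lam : R)
    (v : 'cV[R]_s) :
  gen_eigenvector ((row i Gxa)^T *m row i Gxa) (G^T *m G) lam v ->
  (Gxa *m v) i 0 ^+ 2 = lam * norm2 (G *m v) ^+ 2.
Proof.
move=> [Pv0 _].
have /matrixP/(_ 0 0) : (row i Gxa *m v)^T *m (row i Gxa *m v) =
    lam *: ((G *m v)^T *m (G *m v)).
  apply/eqP; rewrite -subr_eq0 !trmx_mul -!mulmxA scalemxAr -mulmxBr.
  by rewrite 2!mulmxA scalemxAl -mulmxBl Pv0 mulmx0.
by rewrite -row_mul [RHS]mxE norm2_sq => <-; rewrite [RHS]mxE big_ord1 !mxE expr2.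
Qed.

(** * The optimal attack *)

Theorem theorem14 (R : realType) (n m q p pd s : nat)
    (A : 'M[R]_n) (B : 'M[R]_(n, q)) (C : 'M[R]_(p, n))
    (Ac : 'M[R]_m) (Bc : 'M[R]_(m, p)) (Cc : 'M[R]_(q, m)) (Dc : 'M[R]_(q, p))
    (K : 'M[R]_(n, p)) (V : 'M[R]_(pd, p))
    (bB : 'M[R]_(n + m, s)) (Be : 'M[R]_(n, s)) (De : 'M[R]_(pd, s))
    (delta : R) :
  let bA := closed_loop A B C Ac Bc Cc Dc in
  let Ae := detector_A A C K in
  let Ce := detector_C A C K V in
  let Gxa := state_gain bA bB in
  let Gra := residual_gain Ae Be Ce De in
  let e (i : 'I_n) : 'cV[R]_n := col i 1%:M in
  let P (i : 'I_n) : 'M[R]_s := Gxa^T *m e i *m (e i)^T *m Gxa in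
  let Q : 'M[R]_s := Gra^T *m Gra in
  1%:M - bA \in unitmx ->
  1%:M - Ae \in unitmx ->
  Gra <> 0 ->
  0 < delta ->
  bounded_attack_problem Gxa Gra delta ->
  (forall i : 'I_n, exists (lam : R) (v : 'cV[R]_s),
     [/\ largest_gen_eigenvalue (P i) Q lam,
         gen_eigenvector (P i) Q lam v & norm2 v = 1]) /\
  (forall (lam : 'I_n -> R) (v : 'I_n -> 'cV[R]_s) (istar : 'I_n),
     (forall i : 'I_n, largest_gen_eigenvalue (P i) Q (lam i)) ->
     (forall i : 'I_n, gen_eigenvector (P i) Q (lam i) (v i)) ->
     (forall i : 'I_n, norm2 (v i) = 1) ->
     (forall i : 'I_n, lam i <= lam istar) ->
     let lamstar := lam istar in
     let vstar := v istar in
     forall a : 'cV[R]_s,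
       a = (delta / norm2 (Gra *m vstar)) *: vstar \/
       a = - ((delta / norm2 (Gra *m vstar)) *: vstar) ->
       [/\ optimal_attack Gxa Gra delta a,
           `|Gxa *m a| = Num.sqrt lamstar * delta &
           (safe_set R n (Gxa *m a) <-> lamstar * delta ^+ 2 <= 1)]).
Proof.
move=> bA Ae Ce Gxa Gra e P Q _ _ Gra_neq0 delta_gt0 bnd.
have /submxP[U GxaE] := bounded_attack_submx delta_gt0 bnd.
pose mu i := norm2 (Gra *m (row i U)^T) ^+ 2.
have PE i : P i = (row i Gxa)^T *m row i Gxa.
  by rewrite /P /e tr_col trmx1 -(mulmxA (_ *m _)) -row_mul mul1mx
    -[col i _]trmxK tr_col trmx1 -trmx_mul -row_mul mul1mx.
have PQ i : P i = Q *m (row i U)^T *m ((row i U)^T^T *m Q).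
  by rewrite PE trmxK GxaE row_mul [in LHS]trmx_mul /Q trmx_mul trmxK.
have mu_largest i : largest_gen_eigenvalue (P i) Q (mu i).
  by rewrite PQ; exact: largest_gen_eigenvalue_rank_one.
split=> [i|lam v istar lam_largest v_eigen _ lam_le /= a aE].
  have [v0 v0_eigen] := rank_one_gen_eigenvector (row i U)^T Gra_neq0.
  have [w w_eigen w1] := gen_eigenvector_unit v0_eigen.
  by exists (mu i), w; split; rewrite // PQ.
have lamE i : lam i = mu i.
  exact: largest_gen_eigenvalue_unique (lam_largest i) (mu_largest i).
have lam_ge0 : 0 <= lam istar by rewrite lamE sqr_ge0.
set g := norm2 (Gra *m v istar) in aE.
have g_neq0 : g != 0.
  rewrite norm2_eq0; apply/eqP => Gv0; case: (v_eigen istar) => _; apply.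
  by rewrite -mulmxA Gv0 mulmx0.
have g_gt0 : 0 < g by rewrite lt_neqAle norm2_ge0 eq_sym g_neq0.
have c_gt0 : 0 < delta / g by rewrite divr_gt0.
have bound b : stealthy Gra delta b -> `|Gxa *m b| <= Num.sqrt (lam istar) * delta.
  move=> b_stealthy; apply/normmx_le_cV => [|i].
    by rewrite mulr_ge0 ?sqrtr_ge0 // ltW.
  apply: (@le_trans _ _ (Num.sqrt (lam i) * norm2 (Gra *m b))).
    rewrite lamE sqrtr_sqr (ger0_norm (norm2_ge0 _)) GxaE.
    exact: attack_coordinate_le.
  by rewrite ler_pM ?sqrtr_ge0 ?norm2_ge0 // ler_sqrt ?lam_le.
(* The sign of the attack matters to neither constraint nor objective. *)
have [c aEc c_abs] : exists2 c, a = c *: v istar & `|c| = delta / g.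
  case: aE => ->; [exists (delta / g) | exists (- (delta / g))] => //.
  - by rewrite gtr0_norm.
  - by rewrite scaleNr.
  - by rewrite normrN gtr0_norm.
have a_stealthy : stealthy Gra delta a.
  by rewrite /stealthy aEc -scalemxAr norm2Z c_abs divfK.
have a_attains : `|(Gxa *m a) istar 0| = Num.sqrt (lam istar) * delta.
  have := v_eigen istar; rewrite PE => /gen_eigenvector_coordinate coordE.
  rewrite aEc -scalemxAr mxE normrM c_abs -sqrtr_sqr coordE.
  by rewrite sqrtrM // sqrtr_sqr gtr0_norm // mulrCA divfK.
have a_value : `|Gxa *m a| = Num.sqrt (lam istar) * delta.
  apply/eqP; rewrite eq_le bound //= -a_attains.
  exact: (iffLR (normmx_le_cV _ (normr_ge0 _)) (lexx _)).
split=> //; first by split=> // b /bound; rewrite a_value.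
rewrite /safe_set /= a_value.
have value_ge0 : 0 <= Num.sqrt (lam istar) * delta.
  by rewrite mulr_ge0 ?sqrtr_ge0 // ltW.
by rewrite -[X in X * delta ^+ 2](sqr_sqrtr lam_ge0) -exprMn expr_le1.
Qed.
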